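(* Let $D$ be a finite oriented graph (with at least one vertex) such that $\delta^+(D)\le 5$ or $at(D)\le 5$. Then $D$ has a strong Seymour vertex.
   Context: A digraph has no loops and no multiple arcs; $V(D)$ and $A(D)$ denote its vertex set and arc set. An oriented graph is a digraph without 2-cycles (i.e. $(u,v)$ and $(v,u)$ are never both arcs). For a vertex $v$, $N_D^+(v)=\{y:(v,y)\in A(D)\}$ is the set of out-neighbors, $d_D^+(v)=|N_D^+(v)|$ is the out-degree, and $\delta^+(D)$ is the minimum out-degree over all vertices. The second out-neighborhood of $v$ is $$N^{++}_D(v)=\{z\in V(D)\setminus (N_D^+(v)\cup\{v\}) : (v,y),(y,z)\in A(D)\text{ for some }y\in N_D^+(v)\}.$$ For disjoint vertex sets $X,Y$, a matching from $X$ to $Y$ is a set of arcs $(x_i,y_i)\in A(D)$ with $x_i\in X$, $y_i\in Y$, no two of which share an endpoint; it is a complete matching from $X$ to $Y$ if every vertex of $X$ is the tail of some arc of it (for $X=\emptyset$ the empty set is a complete matching). A vertex $x$ is a strong Seymour vertex of $D$ if there is a complete matching from $N^+_D(x)$ to $N^{++}_D(x)$. Paths are directed paths (with distinct vertices), and the length of a path is its number of arcs. For a positive integer $k$, $D$ is $k$-anti-transitive if $(v_0,v_k)\notin A(D)$ for every path $v_0v_1\cdots v_k$ of length $k$ in $D$. $at(D)$ denotes the smallest positive integer $k$ such that $D$ is $k$-anti-transitive. *)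

(* Defs.v *)
From mathcomp Require Import all_boot.

Set Implicit Arguments.
Unset Strict Implicit.
Unset Printing Implicit Defensive.

(** A digraph is a relation [e : rel T] on a finite type [T] of vertices:
    [e u v] holds when [(u, v)] is an arc. *)

Section Digraph.

Variables (T : finType) (e : rel T).

Definition digraph : Prop := irreflexive e.

Definition oriented_graph : Prop :=
  digraph /\ forall u v : T, ~ (e u v /\ e v u).

Definition out_nbrs (v : T) : {set T} := [set y | e v y].

Definition out_degree (v : T) : nat := #|out_nbrs v|.

(** The default [#|T|] bounds every out-degree, so it matters only for the
    empty digraph. *)
Definition min_out_degree : nat := \big[minn/#|T|]_(v : T) out_degree v.

Definition second_out_nbrs (v : T) : {set T} :=
  [set z | z \notin v |: out_nbrs v & [exists y in out_nbrs v, e y z]].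

(** Meant for disjoint [X] and [Y], as [out_nbrs v] and [second_out_nbrs v]
    are by construction. *)
Definition matching (X Y : {set T}) (M : {set T * T}) : Prop :=
  (forall a, a \in M -> [/\ e a.1 a.2, a.1 \in X & a.2 \in Y]) /\
  (forall a b, a \in M -> b \in M -> a != b ->
     [disjoint [set a.1; a.2] & [set b.1; b.2]]).

Definition complete_matching (X Y : {set T}) (M : {set T * T}) : Prop :=
  matching X Y M /\ forall x, x \in X -> exists2 a, a \in M & a.1 = x.

Definition strong_seymour_vertex (x : T) : Prop :=
  exists M, complete_matching (out_nbrs x) (second_out_nbrs x) M.

(** The tuple [p] lists [v_1, ..., v_k]. *)
Definition anti_transitive (k : nat) : bool :=
  [forall v0 : T, forall p : k.-tuple T,
     path e v0 p && uniq (v0 :: p) ==> ~~ e v0 (last v0 p)].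

Lemma ex_anti_transitive : exists k, (0 < k) && anti_transitive k.
Proof.
exists #|T|.+1; apply/forallP => v0; apply/forallP => p.
apply/implyP => /andP[_ /card_uniqP p_uniq].
by have := max_card (mem (v0 :: p)); rewrite p_uniq /= size_tuple ltnNge leqnSn.
Qed.

(** The usual notation is at(D). *)
Definition at_index : nat := ex_minn ex_anti_transitive.

End Digraph.

(* Main.v *)
Require Import Defs.
From mathcomp Require Import all_boot.
From mathcomp Require Import zify.

(** Suppose no vertex is strong Seymour. By Hall's theorem every vertex x has a
    deficient set: S contained in N(x) with fewer than |S| out-neighbours
    outside N(x). If d(x) is the minimum out-degree d, then S has a boundary U
    (out-neighbours of S outside S) with |U| < d, so a vertex of S with k
    out-neighbours in S misses at most k - 1 vertices of U. In particular, a
    vertex y of S with a single out-neighbour p in S ("lone") has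
    N(y) = {p} + U and again out-degree d; a deficient set of y then forces a
    nonempty Q inside U whose vertices have many out-neighbours in Q, {p} and
    N(p) meet S. Three consecutive lone vertices y -> p -> r force out-degree
    at least 2 inside Q.

    If d <= 5, this requires |Q| >= 5 > |U|. Counting arcs shows that the
    out-neighbour of a lone vertex is lone, so there is no lone vertex at all,
    hence S = N(x) is a regular tournament on 5 vertices. A vertex of S of
    out-degree 5 would itself have a regular out-neighbourhood, against the
    few arcs missing between S and U; and if all of S has larger out-degree
    then S dominates U, and a deficient set of a vertex of S gives once more a
    set Q in U with inner out-degree at least 2.

    If D is k-anti-transitive with k <= 5, then S has no path on k vertices,
    and a longest path in S produces either three consecutive lone vertices,
    or a path y -> p -> r -> y' with y and y' lone, which makes U independent
    because y -> p -> r -> y' -> u -> w must not be closed by y -> w. *)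

Section OutSets.

Set Implicit Arguments.
Unset Strict Implicit.

Variables (T : finType) (e : rel T).
Implicit Types (x y z : T) (X Y S Q U : {set T}).

Local Notation N := (out_nbrs e).

(** * Out-neighbourhoods of sets and Hall's theorem *)

Definition out_set X : {set T} := \bigcup_(x in X) N x.

Lemma in_out_nbrs x y : (y \in N x) = e x y.
Proof. by rewrite inE. Qed.

Lemma out_setP X y : reflect (exists2 x, x \in X & e x y) (y \in out_set X).
Proof.
apply: (iffP bigcupP) => [[x xX]|[x xX exy]]; last by exists x; rewrite ?inE.
by rewrite inE => exy; exists x.
Qed.

Lemma sub_out_set X x : x \in X -> N x \subset out_set X.
Proof. exact: bigcup_sup. Qed.

Lemma out_set1 x : out_set [set x] = N x.
Proof. exact: big_set1. Qed.

Lemma out_setU X Y : out_set (X :|: Y) = out_set X :|: out_set Y.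
Proof. exact: bigcup_setU. Qed.

(** Induction on [#|X|], after Halmos and Vaughan. A tight nonempty proper subset and its complement
    are matched separately. If there is none, every nonempty proper subset has a spare neighbour, so
    one arc may be chosen freely and its ends deleted. *)
Lemma hall_marriage X Y :
  (forall S, S \subset X -> #|S| <= #|out_set S :&: Y|) ->
  exists f : T -> T,
    {in X &, injective f} /\ {in X, forall x, f x \in Y /\ e x (f x)}.
Proof.
have [n] := ubnP #|X|; elim: n X Y => // n IHn X Y leXn hallX.
have [->|[x0 x0X]] := set_0Vmem X.
  by exists id; split=> x; rewrite inE.
case: (pickP [pred S : {set T} | [&& S \proper X, S != set0 &
         #|out_set S :&: Y| <= #|S|]]) => [S /and3P[prS S0 tightS]|tightX].
  have sSX := proper_sub prS.
  have [f [f_inj fP]] : exists f : T -> T,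
      {in S &, injective f} /\ {in S, forall x, f x \in Y /\ e x (f x)}.
    apply: IHn => [|S' sS']; first by have := proper_card prS; lia.
    exact: hallX (subset_trans sS' sSX).
  have [g [g_inj gP]] : exists g : T -> T,
      {in X :\: S &, injective g} /\
      {in X :\: S, forall x, g x \in Y :\: out_set S /\ e x (g x)}.
    apply: IHn => [|S' sS'].
      have := cardsID S X; rewrite (setIidPr sSX).
      by move: S0; rewrite -card_gt0; lia.
    have dSS' : [disjoint S & S'].
      rewrite -setI_eq0; apply/eqP/setP=> x; rewrite !inE; apply/negP.
      by case/andP=> xS /(subsetP sS'); rewrite !inE xS.
    have := hallX (S :|: S').
    rewrite subUset sSX (subset_trans sS' (subsetDl _ _)) => /(_ isT).
    have -> : #|S :|: S'| = #|S| + #|S'|.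
      by rewrite cardsU disjoint_setI0 // cards0 subn0.
    suff : #|out_set (S :|: S') :&: Y| <=
        #|out_set S :&: Y| + #|out_set S' :&: (Y :\: out_set S)| by lia.
    apply: leq_trans (leq_card_setU _ _); apply/subset_leq_card/subsetP => z.
    rewrite out_setU !inE; case: (z \in out_set S); case: (z \in Y) => //=;
    by rewrite ?andbF ?orbF ?andbT.
  exists (fun x => if x \in S then f x else g x); split=> [x y xX yX|x xX];
    last first.
    case: ifP => xS; first exact: fP.
    have [|+ gx2] := gP x; first by rewrite inE xS.
    by rewrite inE => /andP[].
  case: ifP => xS; case: ifP => yS fxy; first exact: f_inj.
  - have [|+ _] := gP y; first by rewrite inE yS.
    have [_ efx] := fP x xS.
    by rewrite -fxy inE (subsetP (sub_out_set xS)) // inE.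
  - have [|+ _] := gP x; first by rewrite inE xS.
    have [_ efy] := fP y yS.
    by rewrite fxy inE (subsetP (sub_out_set yS)) // inE.
  - by apply: g_inj => //; rewrite inE ?xS ?yS.
have /card_gt0P[y0] : 0 < #|out_set [set x0] :&: Y|.
  by apply: leq_trans (hallX _ _); rewrite ?cards1 ?sub1set.
rewrite out_set1 !inE => /andP[ex0 y0Y].
have [g [g_inj gP]] : exists g : T -> T,
    {in X :\ x0 &, injective g} /\
    {in X :\ x0, forall x, g x \in Y :\ y0 /\ e x (g x)}.
  apply: IHn => [|S sS]; first by move: leXn; rewrite (cardsD1 x0 X) x0X.
  have [->|S0] := eqVneq S set0; first by rewrite cards0.
  have prS : S \proper X by apply: sub_proper_trans sS (properD1 x0X).
  have := tightX S; rewrite /= prS S0 /= => /negbT; rewrite -ltnNge.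
  rewrite setIDA => ltS; rewrite -ltnS; apply: leq_trans ltS _.
  by rewrite (cardsD1 y0) -add1n leq_add2r leq_b1.
exists (fun x => if x == x0 then y0 else g x); split=> [x y xX yX|x xX];
  last first.
  case: eqVneq => [-> //|xx0].
  have [|+ gx2] := gP x; first by rewrite !inE xx0.
  by rewrite inE => /andP[].
case: eqVneq => [->|xx0]; case: eqVneq => [-> //|yx0] fxy.
- by have [|] := gP y; rewrite !inE ?yx0 // -fxy eqxx.
- by have [|] := gP x; rewrite !inE ?xx0 // fxy eqxx.
- by apply: g_inj => //; rewrite !inE ?xx0 ?yx0.
Qed.

(** * Oriented graphs: Hall's condition at a vertex and arc counting *)

Hypothesis e_oriented : oriented_graph e.

Lemma oriented_irr x : e x x = false.
Proof. exact: e_oriented.1. Qed.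

Lemma oriented_asym x y : e x y -> e y x = false.
Proof.
by move=> exy; apply/negP => eyx; case: (e_oriented.2 x y).
Qed.

Lemma oriented_neq x y : e x y -> x != y.
Proof. by move=> exy; apply/eqP=> xy; move: exy; rewrite xy oriented_irr. Qed.

(** By asymmetry [x] is not in [out_set S], so [out_set S :\: N x] is the part of [out_set S] in the
    second out-neighbourhood, and the hypothesis is Hall's condition. *)
Lemma strong_seymour_hall x :
  (forall S, S \subset N x -> #|S| <= #|out_set S :\: N x|) ->
  strong_seymour_vertex e x.
Proof.
move=> hall.
have second S : S \subset N x ->
    out_set S :&: second_out_nbrs e x = out_set S :\: N x.
  move=> sS; apply/setP => z; rewrite !inE.
  have [/out_setP[y yS eyz]|] := boolP (z \in out_set S);
    last by rewrite andbF.
  have exy : e x y by have := subsetP sS y yS; rewrite inE.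
  rewrite andbT negb_or /=; have -> : z != x.
    by apply: contraTneq eyz => ->; rewrite oriented_asym.
  by case: (e x z) => //=; apply/existsP; exists y; rewrite inE exy.
have [S sS|f [f_inj fP]] := @hall_marriage (N x) (second_out_nbrs e x).
  by rewrite second //; apply: hall.
exists [set (y, f y) | y in N x]; split; last first.
  by move=> y yN; exists (y, f y); rewrite // imset_f.
have dXY y z : y \in N x -> z \in second_out_nbrs e x -> y != z.
  move=> yN; apply: contraTneq => <-; rewrite !inE negb_and.
  by move: yN; rewrite inE => ->; rewrite orbT.
split=> [_ /imsetP[y yN ->]|]; first by have [] := fP y yN.
move=> _ _ /imsetP[y yN ->] /imsetP[z zN ->] yz /=.
have {}yz : y != z by apply: contraNneq yz => ->.
have fyz : f y != f z by apply: contraNneq yz => /f_inj ->.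
have [fy _] := fP y yN; have [fz _] := fP z zN.
rewrite -setI_eq0; apply/eqP/setP=> t; rewrite !inE; apply/negP.
case/andP=> /orP[]/eqP-> /orP[]; apply/negP=> //.
- exact: dXY.
- by rewrite eq_sym; apply: dXY.
Qed.

(** Each pair of vertices carries at most one arc. The equality case, a tournament, serves in
    [out_nbrs_regular]. *)
Lemma double_arcs_le X :
  (\sum_(x in X) #|N x :&: X|) * 2 <= #|X| * #|X|.-1 ?= iff
    [forall x in X, forall y in X, (x != y) ==> e x y || e y x].
Proof.
have cardE x : #|N x :&: X| = \sum_(y in X) e x y.
  rewrite -sum1_card big_mkcond [RHS]big_mkcond /=; apply: eq_bigr => y _.
  by rewrite !inE; case: (e x y); case: (y \in X).
under eq_bigr do rewrite cardE.
have -> : (\sum_(x in X) \sum_(y in X) e x y) * 2 =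
    \sum_(x in X) \sum_(y in X) (e x y + e y x).
  rewrite muln2 -addnn [in X in _ + X]exchange_big -big_split /=.
  by apply: eq_bigr => x _; rewrite big_split.
have -> : #|X| * #|X|.-1 = \sum_(x in X) \sum_(y in X) (x != y : nat).
  rewrite -sum_nat_const; apply: eq_bigr => x xX.
  rewrite [X in X.-1](cardsD1 x) xX /= -sum1_card big_mkcond [RHS]big_mkcond /=.
  by apply: eq_bigr => y _; rewrite !inE eq_sym; case: eqP; case: (y \in X).
apply: leqif_sum => x xX; apply: leqif_sum => y yX.
have [->|xy] /= := eqVneq x y; first by rewrite oriented_irr.
case exy: (e x y); first by rewrite (oriented_asym exy).
by case: (e y x).
Qed.

(** An arc from [x] to [y] excludes its reverse, so the in-neighbours of [y] in [X] lie in
    [U :\: N y]. *)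
Lemma arcs_le X Y U : X \subset U ->
  \sum_(x in X) #|N x :&: Y| <= \sum_(y in Y) #|U :\: N y|.
Proof.
move=> sXU.
have -> : \sum_(x in X) #|N x :&: Y| =
    \sum_(x in X) \sum_(y in Y) (e x y : nat).
  apply: eq_bigr => x _; rewrite -sum1_card big_mkcond [RHS]big_mkcond /=.
  by apply: eq_bigr => y _; rewrite !inE; case: (e x y); case: (y \in Y).
rewrite exchange_big; apply: leq_sum => y _; rewrite -sum1_card.
rewrite big_mkcond [leqRHS]big_mkcond; apply: leq_sum => x _ /=.
case xX: (x \in X) => //; rewrite !inE (subsetP sXU _ xX).
by case exy: (e x y); rewrite // (oriented_asym exy).
Qed.

Lemma min_out_degree_card_ge m X : X != set0 ->
  {in X, forall x, m <= #|N x :&: X|} -> m.*2 < #|X|.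
Proof.
rewrite -card_gt0 => X0 degX; have [+ _] := double_arcs_le X.
have : #|X| * m <= \sum_(x in X) #|N x :&: X|.
  by rewrite -sum_nat_const; apply: leq_sum.
by nia.
Qed.


(** * Deficient sets, traps and lone vertices *)

Section Counterexample.

Variable d : nat.
Hypothesis e_min : forall x, d <= #|N x|.
Hypothesis e_deficient : forall x,
  exists2 S : {set T}, S \subset N x & #|out_set S :\: N x| < #|S|.

Definition boundary S : {set T} := out_set S :\: S.

(** What is kept of a deficient set of a vertex of out-degree [d] once that vertex is forgotten. *)
Definition trap S : bool := (S != set0) && (#|boundary S| < d).

Lemma card_cover X Q Y U :
  #|X| <= #|X :&: (Q :|: Y)| + (#|U :\: Q| + #|X :\: (U :|: Y)|).
Proof.
apply: leq_trans (leq_trans (leq_card_setU _ _)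
  (leq_add (leqnn _) (leq_card_setU _ _))).
apply/subset_leq_card/subsetP=> t; rewrite !inE => ->.
by case: (t \in Q); case: (t \in Y); case: (t \in U).
Qed.

(** The boundary lies in [N x :\: S], of size [d - #|S|], together with [out_set S :\: N x], of size
    less than [#|S|]. *)
Lemma deficient_trap x S : #|N x| = d -> S \subset N x ->
  #|out_set S :\: N x| < #|S| -> trap S.
Proof.
move=> dx sS ltS; rewrite /trap -card_gt0 (leq_ltn_trans _ ltS) //=.
have : #|boundary S| <= #|N x :\: S| + #|out_set S :\: N x|.
  apply: leq_trans (leq_card_setU _ _); apply/subset_leq_card/subsetP=> z.
  by rewrite !in_setU !in_setD; do 3 case: (_ \in _).
by have := cardsID S (N x); rewrite (setIidPr sS); lia.
Qed.

Lemma trap_sub S y : y \in S -> N y \subset S :|: boundary S.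
Proof.
move=> yS; apply: subset_trans (sub_out_set yS) _.
by apply/subsetP=> z; rewrite !in_setU in_setD => ->; case: (z \in S).
Qed.

(** [N y] has at least [d] elements, all in [S] or its boundary, and the boundary has fewer than
    [d]. *)
Lemma trap_miss S y : trap S -> y \in S ->
  #|boundary S :\: N y| < #|N y :&: S|.
Proof.
move=> /andP[_ ltU] yS; have := e_min y.
have : #|N y| <= #|N y :&: S| + #|boundary S :&: N y|.
  apply: leq_trans (leq_card_setU _ _); apply/subset_leq_card/subsetP=> z zN.
  have := subsetP (trap_sub yS) z zN.
  by rewrite !in_setU !in_setI zN andbT.
by have := cardsID (N y) (boundary S); lia.
Qed.

Lemma trap_lone S y p : trap S -> y \in S -> N y :&: S = [set p] ->
  [/\ p \in S, e y p, boundary S \subset N y, #|boundary S|.+1 = d &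
      N y = p |: boundary S].
Proof.
move=> tS yS Np; have := set11 p; rewrite -{1}Np in_setI in_out_nbrs.
case/andP=> eyp pS; have := trap_miss tS yS; rewrite Np cards1 ltnS leqn0.
rewrite cards_eq0 setD_eq0 => sU.
have NyE : N y = p |: boundary S.
  apply/eqP; rewrite eqEsubset subUset sub1set in_out_nbrs eyp sU !andbT.
  apply/subsetP=> z zN; have := subsetP (trap_sub yS) z zN.
  rewrite !in_setU => /orP[zS|->]; last by rewrite orbT.
  by rewrite -Np in_setI zN zS.
split=> //; have := e_min y; have /andP[_] := tS.
by rewrite NyE cardsU1 {2}/boundary in_setD pS /=; lia.
Qed.

Lemma boundary_out S z : z \in boundary S -> (z \in S) = false.
Proof. by rewrite in_setD; case: (z \in S). Qed.

(** Of the at least [d] out-neighbours of [z], few lie in [boundary S :\: Q], and the deficiency of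
    [S'] limits those outside [N y]. If [p] is in [S'], the set [N p :&: S] already uses up part of
    that limit. *)
Lemma lone_deficient S y p S' (Q := S' :\ p) :
  trap S -> y \in S -> N y :&: S = [set p] ->
  S' \subset N y -> #|out_set S' :\: N y| < #|S'| ->
  [/\ Q \subset boundary S, Q != set0,
      p \in S' -> {in Q, forall z,
        #|N p :&: S| < #|N z :&: (Q :|: (p |: N p :&: S))|} &
      p \notin S' -> {in Q, forall z, 1 < #|N z :&: (p |: Q)|}].
Proof.
move=> tS yS Np sS' ltS'; have [pS eyp sU cU NyE] := trap_lone tS yS Np.
have sQ : Q \subset boundary S.
  apply/subsetP=> z; rewrite in_setD1 => /andP[zp /(subsetP sS')].
  by rewrite NyE in_setU1 (negPf zp).
have cQU := cardsID Q (boundary S); rewrite (setIidPr sQ) in cQU.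
have cQ := cardsD1 p S'; rewrite -/Q in cQ.
have outQ z : z \in Q -> N z \subset out_set S'.
  by rewrite in_setD1 => /andP[_] /sub_out_set.
have R_out z : z \in N p :&: S -> (z \in N y) = false.
  rewrite NyE in_setI in_setU1 in_out_nbrs => /andP[/oriented_neq + zS].
  by rewrite eq_sym => /negPf->; apply: contraTF zS => /boundary_out ->.
split=> //.
- case: (boolP (p \in S')) => pS'; last first.
    by rewrite -card_gt0; move: cQ; rewrite (negPf pS'); lia.
  (* If [Q] were empty, [S'] would be [[set p]], with no out-neighbour outside [N y]; but the
     nonempty [N p :&: S] lies there. *)
  have sR : N p :&: S \subset out_set S' :\: N y.
    apply/subsetP=> z zR; rewrite in_setD R_out //=.
    by apply: (subsetP (sub_out_set pS')); case/setIP: zR.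
  rewrite -card_gt0; have := subset_leq_card sR; have := trap_miss tS pS.
  by move: cQ; rewrite pS'; lia.
- move=> pS' z zQ.
  have lt1 : #|N z :\: (boundary S :|: (p |: N p :&: S))| + #|N p :&: S| <
      #|S'|.
    (* Writing a subtracted 0 as the size of an empty intersection turns the sum into the size of a
       disjoint union. *)
    apply: leq_ltn_trans ltS'; rewrite -[X in X <= _]subn0 -(cards0 T).
    rewrite -[set0](_ : (N z :\: (boundary S :|: (p |: N p :&: S))) :&:
      (N p :&: S) = _); last first.
      apply/setP=> t; rewrite in_setI in_setD 2!in_setU in_set0.
      by case: (t \in N p :&: S); rewrite ?orbT ?andbF.
    rewrite -cardsU; apply/subset_leq_card/subsetP=> t.
    rewrite in_setU => /orP[|tR]; last first.
      rewrite in_setD R_out //=.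
      by apply: (subsetP (sub_out_set pS')); case/setIP: tR.
    rewrite in_setD in_setU => /andP[+ tN]; rewrite negb_or in_setD.
    rewrite (subsetP (outQ z zQ)) // andbT NyE !in_setU1.
    by case: (t == p); case: (t \in boundary S).
  have := card_cover (N z) Q (p |: N p :&: S) (boundary S).
  by move: cQ (e_min z); rewrite pS'; lia.
move=> pS' z zQ.
have lt1 : #|N z :\: N y| < #|S'|.
  apply: leq_ltn_trans ltS'; apply/subset_leq_card.
  by apply: setSD; apply: outQ.
have := card_cover (N z) Q [set p] (boundary S).
rewrite [Q :|: _]setUC [boundary S :|: _]setUC -NyE.
by move: cQ (e_min z); rewrite (negPf pS'); lia.
Qed.

(** Being lone, [p] and [r] dominate the boundary, so [Q] sends no arc back to them and the
    out-neighbours found by [lone_deficient] lie in [Q]. *)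
Lemma lone_chain S y p r t : trap S -> y \in S ->
    N y :&: S = [set p] -> N p :&: S = [set r] -> N r :&: S = [set t] ->
  exists Q, [/\ Q \subset boundary S, Q != set0 &
    {in Q, forall z, 1 < #|N z :&: Q|}].
Proof.
move=> tS yS Np Nr Nt; have [S' sS' ltS'] := e_deficient y.
have [pS _ _ _ _] := trap_lone tS yS Np.
have [rS _ sUp _ _] := trap_lone tS pS Nr.
have [_ _ sUr _ _] := trap_lone tS rS Nt.
have [sQ Q0 in_S' notin_S'] := lone_deficient tS yS Np sS' ltS'.
exists (S' :\ p); split=> // z zQ.
have zU := subsetP sQ z zQ.
have zp : e z p = false.
  by apply/oriented_asym; have := subsetP sUp z zU; rewrite inE.
have zr : e z r = false.
  by apply/oriented_asym; have := subsetP sUr z zU; rewrite inE.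
have [pS'|pS'] := boolP (p \in S').
  have := in_S' pS' z zQ; rewrite Nr cards1 => /leq_trans; apply.
  apply/subset_leq_card/subsetP => w; rewrite !(in_setI, in_setU, in_set1).
  rewrite in_out_nbrs => /andP[ezw /or3P[wQ|/eqP we|/eqP we]].
  - by rewrite ezw wQ.
  - by move: ezw; rewrite we zp.
  - by move: ezw; rewrite we zr.
apply: leq_trans (notin_S' pS' z zQ) _.
apply/subset_leq_card/subsetP => w; rewrite !(in_setI, in_setU, in_set1).
rewrite in_out_nbrs => /andP[ezw /orP[/eqP we|wQ]].
  by move: ezw; rewrite we zp.
by rewrite ezw wQ.
Qed.

(** * Minimum out-degree at most 5 *)

Lemma trap_miss_sum S : trap S ->
  \sum_(y in S) #|boundary S :\: N y| + #|S| <= \sum_(y in S) #|N y :&: S|.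
Proof.
move=> tS; rewrite -[#|S|]sum1_card -big_split /=.
by apply: leq_sum => y yS; rewrite addn1; apply: trap_miss.
Qed.

(** Arcs leaving [Q] are counted twice: [lone_deficient] demands many, while those into [S] reverse
    missing arcs from [S] to the boundary, which are few. The last hypothesis settles the borderline
    cases with [#|S| = 5]. *)
Lemma lone_next_lone S S' y p : d <= 5 -> #|S| <= 5 -> trap S -> y \in S ->
    N y :&: S = [set p] ->
    S' \subset N y -> #|out_set S' :\: N y| < #|S'| ->
    (#|S| = 5 -> #|S'| = 5) ->
  exists r, N p :&: S = [set r].
Proof.
move=> d5 S5 tS yS Np sS' ltS' card_S'; apply/cards1P.
have [pS eyp _ cU _] := trap_lone tS yS Np.
have [sQ Q0 in_S' notin_S'] := lone_deficient tS yS Np sS' ltS'.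
set Q := S' :\ p in sQ Q0 in_S' notin_S'.
have k_gt0 : 0 < #|N p :&: S| by apply: leq_ltn_trans (trap_miss tS pS).
have k_le : #|N p :&: S| + 2 <= #|S|.
  have ypS : [set y; p] \subset S by rewrite subUset !sub1set yS.
  rewrite -(cardsID [set y; p] S) (setIidPr ypS) cards2 oriented_neq //.
  rewrite addnC leq_add2l; apply/subset_leq_card/subsetP => w.
  rewrite !inE => /andP[epw ->]; rewrite andbT negb_or.
  rewrite [w == p]eq_sym (oriented_neq epw) andbT.
  by apply: contraTneq epw => ->; rewrite oriented_asym.
have miss := trap_miss_sum tS.
have [arcsS _] := double_arcs_le S.
have [arcsQ _] := double_arcs_le Q.
have cQ := subset_leq_card sQ.
have cS' := cardsD1 p S'; rewrite -/Q in cS'.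
rewrite -card_gt0 in Q0.
have sum_le Y : \sum_(z in Q) #|N z :&: (Q :|: Y)| <=
    \sum_(z in Q) #|N z :&: Q| + \sum_(w in Y) #|boundary S :\: N w|.
  apply: leq_trans (leq_add (leqnn _) (arcs_le Y sQ)).
  rewrite -big_split; apply: leq_sum => z _ /=.
  by rewrite setIUr leq_card_setU.
have [pS'|pS'] := boolP (p \in S').
  have lt1 : #|Q| * (#|N p :&: S|.+1) <=
      \sum_(z in Q) #|N z :&: (Q :|: (p |: N p :&: S))|.
    by rewrite -sum_nat_const; apply: leq_sum; apply: in_S'.
  have lt2 := sum_le (p |: N p :&: S).
  have : \sum_(w in p |: N p :&: S) #|boundary S :\: N w| <=
      \sum_(y in S) #|boundary S :\: N y|.
    rewrite big_mkcond [leqRHS]big_mkcond; apply: leq_sum => w _.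
    rewrite in_setU1 in_setI; case: eqP => [->|_] /=; first by rewrite pS.
    by case: (w \in S); rewrite ?andbF //; case: (w \in N p).
  rewrite pS' in cS'.
  (* [Q] lies in the boundary, which has [d - 1 <= 4] vertices. *)
  have kQ : #|Q| = 1 \/ #|Q| = 2 \/ #|Q| = 3 \/ #|Q| = 4 by lia.
  have kS : #|S| = 3 \/ #|S| = 4 \/ #|S| = 5 by lia.
  have kp : #|N p :&: S| = 1 \/ #|N p :&: S| = 2 \/ #|N p :&: S| = 3 by lia.
  move: kQ kS kp card_S' lt1 arcsQ arcsS cS' miss lt2 k_le; clear.
  by move=> [->|[->|[->| ->]]] [->|[->| ->]] [->|[->| ->]]; lia.
have lt1 : #|Q| * 2 <= \sum_(z in Q) #|N z :&: (Q :|: [set p])|.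
  rewrite -sum_nat_const; apply: leq_sum => z zQ.
  by rewrite [Q :|: _]setUC; apply: notin_S'.
have := sum_le [set p]; rewrite big_set1.
have := trap_miss tS pS; rewrite (negPf pS') in cS'.
have kQ : #|Q| = 1 \/ #|Q| = 2 \/ #|Q| = 3 \/ #|Q| = 4 by lia.
move: kQ arcsQ lt1 S5 card_S' cS' cU d5 cQ k_le k_gt0; clear.
by move=> [->|[->|[->| ->]]]; lia.
Qed.

(** The last hypothesis allows two uses: it is vacuous for [#|S| < 5], which yields
    [deficient_size5], and that lemma then supplies it for [#|S| = 5]. *)
Lemma small_trap_no_lone S y p : d <= 5 -> #|S| <= 5 -> trap S ->
    y \in S -> N y :&: S = [set p] ->
    (forall x S', #|N x| = d -> S' \subset N x ->
       #|out_set S' :\: N x| < #|S'| -> #|S| = 5 -> #|S'| = 5) ->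
  False.
Proof.
move=> d5 S5 tS yS Np all5.
have next u v : u \in S -> N u :&: S = [set v] ->
    v \in S /\ exists w, N v :&: S = [set w].
  move=> uS Nv; have [vS _ _ cU NuE] := trap_lone tS uS Nv; split=> //.
  have [S' sS' ltS'] := e_deficient u.
  apply: (lone_next_lone d5 S5 tS uS Nv sS' ltS'); apply: (all5 u) => //.
  by rewrite NuE cardsU1 in_setD vS.
have [pS [r Nr]] := next y p yS Np; have [rS [t Nt]] := next p r pS Nr.
have [Q [sQ Q0 degQ]] := lone_chain tS yS Np Nr Nt.
have := min_out_degree_card_ge Q0 degQ; have := subset_leq_card sQ.
by have /andP[_] := tS; lia.
Qed.

Lemma not_lone_degree S y : trap S -> y \in S ->
  (forall p, N y :&: S <> [set p]) -> 2 <= #|N y :&: S|.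
Proof.
move=> tS yS not_lone; have := trap_miss tS yS.
by case kE: #|N y :&: S| => [|[|k]] //; move/eqP/cards1P: kE => [p /not_lone].
Qed.

Lemma deficient_size5 x S : d <= 5 -> #|N x| = d -> S \subset N x ->
  #|out_set S :\: N x| < #|S| -> #|S| = 5.
Proof.
move=> d5 dx sS ltS; have tS := deficient_trap dx sS ltS.
apply/eqP/negPn/negP => /eqP S5.
have leS := subset_leq_card sS.
have : #|S| * 2 <= \sum_(y in S) #|N y :&: S|.
  rewrite -sum_nat_const; apply: leq_sum => y yS.
  apply: not_lone_degree => // p Np.
  by apply: (small_trap_no_lone (S := S) (y := y) (p := p)) => //; lia.
by have [+ _] := double_arcs_le S; nia.
Qed.

Lemma out_nbrs_regular x : d <= 5 -> #|N x| = d ->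
  [/\ #|N x| = 5, trap (N x), {in N x, forall y, #|N y :&: N x| = 2} &
      {in N x &, forall y z, y != z -> e y z || e z y}].
Proof.
move=> d5 dx; have [S sS ltS] := e_deficient x.
have S5 := deficient_size5 d5 dx sS ltS.
have SE : S = N x by apply/eqP; rewrite eqEcard sS S5 dx.
have tS := deficient_trap dx sS ltS; rewrite {}SE in sS ltS S5 tS.
have deg2 y : y \in N x -> 2 <= #|N y :&: N x|.
  move=> yS; apply: not_lone_degree => // p Np.
  apply: (small_trap_no_lone (S := N x) (y := y) (p := p)) => //.
    by rewrite S5.
  by move=> w S' dw sS' ltS' _; apply: deficient_size5 dw sS' ltS'.
(* Ten arcs is both the lower bound from degrees and the upper bound for 5 vertices; the two
   equality cases give regularity and the tournament property. *)
have sum2 := leqif_sum (fun y yS => leqif_eq (deg2 y yS)).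
have arcs := double_arcs_le (N x).
rewrite sum_nat_const S5 in sum2; rewrite S5 in arcs.
have sumE : \sum_(y in N x) #|N y :&: N x| = 10.
  by have := sum2.1; have := arcs.1; lia.
split=> // [y yS|y z yS zS yz].
  have := sum2.2; rewrite sumE eqxx => /esym/forall_inP/(_ y yS)/eqP.
  by move->.
have := arcs.2; rewrite sumE eqxx => /esym/forall_inP/(_ y yS).
by move/forall_inP/(_ z zS)/implyP/(_ yz).
Qed.

Lemma min_out_degree_gt5 x : #|N x| = d -> 5 < d.
Proof.
move=> dx; rewrite ltnNge; apply/negP => d5.
have [Nx5 tS deg2 adj] := out_nbrs_regular d5 dx.
set S := N x in tS deg2 adj.
have cU := andP tS; have {cU} [_ cU] := cU.
have degU y : y \in S -> #|N y :&: boundary S| + 2 = #|N y|.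
  move=> yS; rewrite addnC -(deg2 y yS) -(cardsID S (N y)); congr (_ + _).
  apply: eq_card => w; rewrite !in_setI [RHS]in_setD in_setD andbC.
  case wN: (w \in N y); rewrite ?andbF //= andbT.
  by rewrite (subsetP (sub_out_set yS)) ?andbT.
have [/existsP[y /andP[yS /eqP dy]]|] :=
    boolP [exists y, (y \in S) && (#|N y| == d)].
  have [Ny5 tNy deg2y _] := out_nbrs_regular d5 dy.
  (* Three vertices of [N y] lie in the boundary and [p] misses at most one of them; with [q] this
     would make three out-neighbours of [p] in [N y], instead of two. *)
  have no_arc p q : p \in N y :&: S -> q \in N y :&: S -> e p q = false.
    move=> /setIP[pNy pS] /setIP[qNy qS]; apply/negP => epq.
    have sub : q |: (N p :&: (N y :&: boundary S)) \subset N p :&: N y.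
      rewrite subUset sub1set in_setI qNy in_out_nbrs epq /=.
      by apply: setIS; apply: subsetIl.
    have := subset_leq_card sub; rewrite deg2y // cardsU1.
    rewrite 2!in_setI [q \in boundary S]in_setD qS !andbF /=.
    have : #|N y :&: boundary S| <= #|N p :&: (N y :&: boundary S)| +
        #|boundary S :\: N p|.
      apply: leq_trans (leq_card_setU _ _); apply/subset_leq_card/subsetP=> w.
      rewrite in_setU in_setD 3!in_setI => /andP[-> ->].
      by case: (w \in N p).
    by have := trap_miss tS pS; rewrite deg2 //; have := degU y yS; lia.
  have /cards2P[p [q [pq Npq]]] : #|N y :&: S| == 2 by rewrite deg2.
  have pP : p \in N y :&: S by rewrite Npq set21.
  have qP : q \in N y :&: S by rewrite Npq set22.
  have /setIP[_ pS] := pP; have /setIP[_ qS] := qP.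
  by have := adj p q pS qS pq; rewrite !no_arc.
move=> /existsPn big_deg.
(* Out-degree above [d] with only two out-neighbours inside [S] leaves at least [d - 1] in the
   boundary, hence all of it. *)
have fullU y : y \in S -> boundary S \subset N y.
  move=> yS; have := big_deg y; rewrite yS /= => neq.
  have := degU y yS; have := e_min y => dy degy.
  have le : #|boundary S| <= #|N y :&: boundary S| by lia.
  by apply/setIidPr/eqP; rewrite eqEcard subsetIr.
have U_S z w : z \in boundary S -> w \in S -> e z w = false.
  move=> zU wS; apply: oriented_asym.
  by have := subsetP (fullU w wS) z zU; rewrite in_out_nbrs.
have [y yS] : exists y, y \in S by apply/card_gt0P; rewrite Nx5.
have [S' sS' ltS'] := e_deficient y.
pose P := S' :&: S; pose Q := S' :\: S.
have sP : P \subset N y :&: S by rewrite setSI.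
have sQ : Q \subset boundary S.
  apply/subsetP=> z; rewrite in_setD => /andP[zS /(subsetP sS') zN].
  by have := subsetP (trap_sub yS) z zN; rewrite in_setU (negPf zS).
have outP p : p \in P -> N p :&: S \subset (out_set P :&: S) :|: N y.
  move=> pP; apply/subsetP => w /setIP[pw wS]; rewrite in_setU in_setI wS.
  by rewrite (subsetP (sub_out_set pP)).
(* [P] lies in the pair [N y :&: S]. Each of its vertices has two out-neighbours in [S], at most one
   of them in the pair; if [P] is the whole pair, one of its vertices has none there. *)
have P_le : #|P| <= #|(out_set P :&: S) :\: N y|.
  have out_ge p : p \in P ->
      2 <= #|(out_set P :&: S) :\: N y| + #|N p :&: (N y :&: S)|.
    move=> pP; have /setIP[_ pS] := pP; rewrite -(deg2 p pS).
    apply: leq_trans (leq_card_setU _ _); apply/subset_leq_card/subsetP => w.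
    rewrite in_setI => /andP[pw wS].
    rewrite in_setU in_setD 3!in_setI pw wS !andbT /=.
    by rewrite (subsetP (sub_out_set pP)) // andbT; case: (w \in N y).
  have := subset_leq_card sP; rewrite deg2 // => P2.
  have /cards2P[p [q [pq Npq]]] : #|N y :&: S| == 2 by rewrite deg2.
  have in1 u v : [set u; v] = N y :&: S -> u \in P ->
      #|N u :&: (N y :&: S)| <= e u v.
    move=> <- uP; have [euv|euv] := boolP (e u v).
      rewrite -[leqRHS](cards1 v); apply/subset_leq_card/subsetP => w.
      rewrite !inE => /andP[euw /orP[/eqP wu|//]].
      by move: euw; rewrite wu oriented_irr.
    rewrite leqn0 cards_eq0; apply/eqP/setP=> w; rewrite !inE.
    apply/negP=> /andP[euw /orP[]/eqP wE]; move: euw; rewrite wE.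
      by rewrite oriented_irr.
    by rewrite (negPf euv).
  have [->|[u uP]] := set_0Vmem P; first by rewrite cards0.
  have [P1|P_gt1] := leqP #|P| 1.
    apply: leq_trans P1 _.
    have [v vE] : exists v, [set u; v] = N y :&: S.
      have := subsetP sP u uP; rewrite Npq !inE => /orP[]/eqP->.
        by exists q.
      by exists p; rewrite setUC.
    by have := out_ge u uP; have := in1 u v vE uP; have := leq_b1 (e u v); lia.
  have PE : P = [set p; q].
    by rewrite -Npq; apply/eqP; rewrite eqEcard sP deg2.
  have pP : p \in P by rewrite PE set21.
  have qP : q \in P by rewrite PE set22.
  have in_qp := in1 q p _ qP; rewrite setUC in in_qp.
  move: P2 (out_ge p pP) (out_ge q qP).
  move: (in1 p q (esym Npq) pP) (in_qp (esym Npq)).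
  case epq: (e p q); rewrite ?(oriented_asym epq); case: (e q p); clear; lia.
have cS' := cardsID S S'; rewrite -/P -/Q in cS'.
(* [P] accounts for at least [#|P|] of the out-neighbours of [S'] outside [N y], all in [S], so the
   deficiency passes to [Q]. *)
have ltQ : #|out_set Q :\: boundary S| < #|Q|.
  have : #|(out_set P :&: S) :\: N y| + #|out_set Q :\: boundary S| <=
      #|out_set S' :\: N y|.
    rewrite -[X in X <= _]subn0 -(cards0 T).
    rewrite -[set0](_ : ((out_set P :&: S) :\: N y) :&:
        (out_set Q :\: boundary S) = _); last first.
      apply/setP=> w; rewrite in_set0; apply/negP.
      rewrite in_setI => /andP[/setDP[/setIP[_ wS] _] /setDP[wQ _]].
      by have [z /(subsetP sQ) zU] := out_setP _ _ wQ; rewrite U_S.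
    rewrite -cardsU; apply/subset_leq_card/subsetP => w.
    rewrite in_setU => /orP[/setDP[/setIP[wP _] wN]|/setDP[wQ wU]].
      have [p /setIP[pS' _] epw] := out_setP _ _ wP.
      by rewrite in_setD wN; apply/out_setP; exists p.
    have [z zQ ezw] := out_setP _ _ wQ.
    have zS' : z \in S' by case/setDP: zQ.
    rewrite in_setD; apply/andP; split; last by apply/out_setP; exists z.
    apply: contraNN wU => /(subsetP (trap_sub yS)); rewrite in_setU.
    case/orP=> // wS; move: ezw; rewrite U_S //.
    exact: (subsetP sQ).
  by lia.
have Q0 : Q != set0 by rewrite -card_gt0; lia.
have := @min_out_degree_card_ge 2 Q Q0.
have cQ := subset_leq_card sQ.
have cQU := cardsID Q (boundary S); rewrite (setIidPr sQ) in cQU.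
suff deg z : z \in Q -> 2 <= #|N z :&: Q| by move/(_ deg); lia.
move=> zQ; have := card_cover (N z) Q set0 (boundary S).
rewrite !setU0; have := e_min z.
have : #|N z :\: boundary S| <= #|out_set Q :\: boundary S|.
  by apply/subset_leq_card/setSD/sub_out_set.
by lia.
Qed.

(** * Anti-transitivity: forbidden configurations of lone vertices *)

Lemma anti_transitive_path k x s : anti_transitive e k -> size s = k ->
  path e x s -> uniq (x :: s) -> ~~ e x (last x s).
Proof.
move=> /forallP/(_ x)/forallP atk /eqP sk ps us.
by have /implyP := atk (Tuple sk); apply; rewrite ps.
Qed.

Lemma trap_next S y : trap S -> y \in S -> exists2 z, z \in S & e y z.
Proof.
move=> tS yS; have /card_gt0P[z] : 0 < #|N y :&: S|.
  exact: leq_ltn_trans (trap_miss tS yS).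
by rewrite in_setI in_out_nbrs => /andP[eyz zS]; exists z.
Qed.

Lemma loneI S y p : trap S -> y \in S -> {in S, forall w, e y w -> w = p} ->
  N y :&: S = [set p].
Proof.
move=> tS yS only_p; have [z zS eyz] := trap_next tS yS.
apply/setP=> w; rewrite in_setI in_out_nbrs in_set1; apply/andP/eqP.
  by case=> eyw wS; apply: only_p.
by move->; rewrite -(only_p z zS eyz).
Qed.

(** The set [Q] of [lone_chain] contains a path [u], [v], [w]. The path [y], [p], [r], [u], [v],
    extended by [w] if [k = 5], is closed by an arc from [y], which dominates the boundary. *)
Lemma no_lone_chain k S y p r t : anti_transitive e k -> 3 < k <= 5 ->
    trap S -> y \in S ->
    N y :&: S = [set p] -> N p :&: S = [set r] -> N r :&: S = [set t] ->
  False.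
Proof.
move=> atk k45 tS yS Ny Np Nr.
have [Q [sQ Q0 degQ]] := lone_chain tS yS Ny Np Nr.
have [pS eyp sUy _ _] := trap_lone tS yS Ny.
have [rS epr _ _ _] := trap_lone tS pS Np.
have [_ _ sUr _ _] := trap_lone tS rS Nr.
have arcU z v : z \in boundary S -> v \in S -> boundary S \subset N v -> e v z.
  by move=> zU vS /subsetP/(_ z zU); rewrite in_out_nbrs.
have neqU z v : z \in boundary S -> v \in S -> v != z.
  by move=> zU; apply: contraTneq => ->; rewrite boundary_out.
have next z : z \in Q -> exists2 w, w \in Q & e z w.
  move=> /degQ; case: (set_0Vmem (N z :&: Q)) => [->|[w]]; rewrite ?cards0 //.
  by rewrite in_setI in_out_nbrs => /andP[ezw wQ]; exists w.
have [u uQ] := set0Pn _ Q0; have [v vQ euv] := next u uQ.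
have [w wQ evw] := next v vQ.
have [uU vU wU] : [/\ u \in boundary S, v \in boundary S & w \in boundary S].
  by split; apply: (subsetP sQ).
have yr : y != r by apply: contraTneq epr => <-; rewrite oriented_asym.
have uw : u != w by apply: contraTneq evw => <-; rewrite oriented_asym.
have [k4|k5] : k = 4 \/ k = 5 by move: k45; clear; lia.
  have := anti_transitive_path atk (esym k4 : size [:: p; r; u; v] = k).
  move=> /(_ y) /=; rewrite eyp epr (arcU u r) // euv (arcU v y) // => noarc.
  apply: notF; apply: noarc => //; rewrite !inE !negb_or.
  by do ![apply/andP; split] => //;
     first [exact: oriented_neq | by apply: neqU].
have := anti_transitive_path atk (esym k5 : size [:: p; r; u; v; w] = k).
move=> /(_ y) /=; rewrite eyp epr (arcU u r) // euv evw (arcU w y) // => noarc.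
apply: notF; apply: noarc => //; rewrite !inE !negb_or.
by do ![apply/andP; split] => //; first [exact: oriented_neq | by apply: neqU].
Qed.

(** The inner hypothesis says that [S] has no path on four vertices. Then a path on three vertices
    closes to a triangle of lone vertices. *)
Lemma trap_path4 k S : anti_transitive e k -> 3 < k <= 5 -> trap S ->
  (forall a b c f, a \in S -> b \in S -> c \in S -> f \in S ->
     e a b -> e b c -> e c f -> f <> a -> False) -> False.
Proof.
move=> atk k45 tS no_path4; have /andP[/set0Pn[a aS] _] := tS.
have [b bS eab] := trap_next tS aS; have [c cS ebc] := trap_next tS bS.
have end_lone u v w : u \in S -> v \in S -> w \in S -> e u v -> e v w ->
    N w :&: S = [set u].
  move=> uS vS wS euv evw; apply: loneI => // z zS ewz.
  by apply/eqP/negPn/negP=> /eqP; apply: (no_path4 u v w z).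
have Nc := end_lone a b c aS bS cS eab ebc.
have [_ eca _ _ _] := trap_lone tS cS Nc.
have Na := end_lone b c a bS cS aS ebc eca.
have Nb := end_lone c a b cS aS bS eca eab.
exact: no_lone_chain atk k45 tS aS Na Nb Nc.
Qed.

(** With the boundary independent, [lone_deficient] either makes some [z] of the boundary dominate
    [p |: (N p :&: S)], hence [t], although the lone [t] dominates [z], or asks for two
    out-neighbours of [z] in [[set p]]. *)
Lemma no_lone_detour S y p r y' q t : anti_transitive e 5 -> trap S ->
    y \in S -> N y :&: S = [set p] ->
    r \in S -> e p r -> y' \in S -> e r y' -> y' != y -> N y' :&: S = [set q] ->
    t \in p |: (N p :&: S) -> (exists v, N t :&: S = [set v]) ->
  False.
Proof.
move=> at5 tS yS Ny rS epr y'S ery' y'y Ny' tp [v Nt].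
have [pS eyp sUy _ _] := trap_lone tS yS Ny.
have [_ _ sUy' _ _] := trap_lone tS y'S Ny'.
have tS' : t \in S.
  by move: tp; rewrite in_setU1 in_setI => /orP[/eqP->|/andP[]].
have [_ _ sUt _ _] := trap_lone tS tS' Nt.
have arcU z w : z \in boundary S -> w \in S -> boundary S \subset N w -> e w z.
  by move=> zU wS /subsetP/(_ z zU); rewrite in_out_nbrs.
have neqU z w : z \in boundary S -> w \in S -> w != z.
  by move=> zU; apply: contraTneq => ->; rewrite boundary_out.
have U_indep u w : u \in boundary S -> w \in boundary S -> e u w = false.
  move=> uU wU; apply/negP=> euw.
  have := anti_transitive_path at5 (erefl : size [:: p; r; y'; u; w] = 5).
  move=> /(_ y) /=; rewrite eyp epr ery' (arcU u y') // euw (arcU w y) //.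
  have yr : y != r by apply: contraTneq epr => <-; rewrite oriented_asym.
  have py' : p != y' by apply: contraTneq ery' => <-; rewrite oriented_asym.
  move=> noarc; apply: notF; apply: noarc => //; rewrite !inE !negb_or.
  by do ![apply/andP; split] => //;
     first [exact: oriented_neq | by rewrite eq_sym | by apply: neqU].
have [S' sS' ltS'] := e_deficient y.
have [sQ /set0Pn[z zQ] in_S' notin_S'] := lone_deficient tS yS Ny sS' ltS'.
have zU := subsetP sQ z zQ.
have outQ Y : N z :&: (S' :\ p :|: Y) = N z :&: Y.
  apply/setP=> w; rewrite 2!in_setI in_setU in_out_nbrs.
  have [ezw|//] := boolP (e z w); case: (boolP (w \in S' :\ p)) => //= wQ.
  by move: ezw; rewrite U_indep // (subsetP sQ).
have [pS'|pS'] := boolP (p \in S').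
  have := in_S' pS' z zQ; rewrite outQ => lt1.
  have : N z :&: (p |: N p :&: S) == p |: N p :&: S.
    rewrite eqEcard subsetIr; apply: leq_trans lt1.
    by rewrite cardsU1 -add1n leq_add2r leq_b1.
  move/eqP/setP/(_ t); rewrite in_setI tp andbT in_out_nbrs => ezt.
  by have := arcU z t zU tS' sUt; rewrite oriented_asym.
have := notin_S' pS' z zQ; rewrite setUC outQ ltnNge => /negP; apply.
by rewrite -(cards1 p) subset_leq_card ?subsetIr.
Qed.

(** * A trap without paths on five vertices has none on four *)

Section Paths5.

Variable S : {set T}.
Hypotheses (at5 : anti_transitive e 5) (tS : trap S).
Hypothesis no_path5 : forall s, size s = 5 -> {subset s <= S} -> uniq s ->
  ~~ sorted e s.

Lemma path4_end a b c f : a \in S -> b \in S -> c \in S -> f \in S ->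
  e a b -> e b c -> e c f -> f != a ->
  {in S, forall w, e f w -> w = a \/ w = b}.
Proof.
move=> aS bS cS fS eab ebc ecf fa w wS efw.
have [|wa] := eqVneq w a; first by left.
have [|wb] := eqVneq w b; first by right.
have ac : a != c by apply: contraTneq ebc => <-; rewrite oriented_asym.
have bf : b != f by apply: contraTneq ecf => <-; rewrite oriented_asym.
have cw : c != w by apply: contraTneq efw => <-; rewrite oriented_asym.
have := no_path5 (erefl : size [:: a; b; c; f; w] = 5).
rewrite /= eab ebc ecf efw !inE !negb_or (oriented_neq eab) ac bf cw.
rewrite (oriented_neq ebc) (oriented_neq ecf) (oriented_neq efw).
rewrite [a == f]eq_sym fa [a == w]eq_sym wa [b == w]eq_sym wb /= => no_path.
exfalso; apply: notF; apply: no_path => // z; rewrite !inE.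
by case/or4P=> [/eqP->|/eqP->|/eqP->|/orP[]/eqP->].
Qed.

(** By [path4_end] on rotations of the cycle, [a] and [f] are lone, so [a], [b], [c], [f] is a
    detour; [t] is [f] if [b] dominates [f], and otherwise [b], which is then lone. *)
Lemma cycle4_chord a b c f : a \in S -> b \in S -> c \in S -> f \in S ->
  e a b -> e b c -> e c f -> e f a -> ~~ e a c -> ~~ e f b -> False.
Proof.
move=> aS bS cS fS eab ebc ecf efa nac nfb.
have ca : c != a by apply: contraTneq ebc => ->; rewrite oriented_asym.
have bf : b != f by apply: contraTneq ecf => <-; rewrite oriented_asym.
have Na : N a :&: S = [set b].
  apply: loneI => // w wS eaw.
  have [] // := path4_end bS cS fS aS ebc ecf efa _ wS eaw.
    by rewrite oriented_neq.
  by move=> wc; rewrite -wc eaw in nac.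
have Nf : N f :&: S = [set a].
  apply: loneI => // w wS efw.
  have [] // := path4_end aS bS cS fS eab ebc ecf _ wS efw.
    by rewrite oriented_neq.
  by move=> wb; rewrite -wb efw in nfb.
have [ebf|nbf] := boolP (e b f).
  apply: (no_lone_detour at5 tS aS Na cS ebc fS ecf _ Nf (t := f)).
  - by rewrite oriented_neq.
  - by rewrite in_setU1 in_setI in_out_nbrs ebf fS orbT.
  - by exists a.
apply: (no_lone_detour at5 tS aS Na cS ebc fS ecf _ Nf (t := b)).
- by rewrite oriented_neq.
- exact: setU11.
exists c; apply: loneI => // w wS ebw.
have [] // := path4_end cS fS aS bS ecf efa eab _ wS ebw.
  by rewrite oriented_neq.
by move=> wf; rewrite -wf ebw in nbf.
Qed.


(** Whichever diagonals are present, some rotation of the cycle meets the hypotheses of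
    [cycle4_chord]. *)
Lemma no_cycle4 a b c f : a \in S -> b \in S -> c \in S -> f \in S ->
  e a b -> e b c -> e c f -> e f a -> False.
Proof.
move=> aS bS cS fS eab ebc ecf efa.
have [eac|nac] := boolP (e a c); have [ebf|nbf] := boolP (e b f).
- by apply: (@cycle4_chord f a b c); rewrite // oriented_asym.
- by apply: (@cycle4_chord c f a b); rewrite // oriented_asym.
- by apply: (@cycle4_chord a b c f); rewrite // oriented_asym.
- exact: (@cycle4_chord b c f a).
Qed.

Lemma no_path4 a b c f : a \in S -> b \in S -> c \in S -> f \in S ->
  e a b -> e b c -> e c f -> f <> a -> False.
Proof.
move=> aS bS cS fS eab ebc ecf /eqP fa.
have Nf : N f :&: S = [set b].
  apply: loneI => // w wS efw.
  have [wa|//] := path4_end aS bS cS fS eab ebc ecf fa wS efw.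
  by case: (no_cycle4 aS bS cS fS eab ebc ecf); rewrite -wa.
have [_ efb _ _ _] := trap_lone tS fS Nf.
have ac : a != c by apply: contraTneq ebc => <-; rewrite oriented_asym.
have [/existsP[w /and3P[wS ebw wc]]|only_c] :=
    boolP [exists w, [&& w \in S, e b w & w != c]].
  have wa : w != a by apply: contraTneq ebw => ->; rewrite oriented_asym.
  have wf : w != f by apply: contraTneq ebw => ->; rewrite oriented_asym.
  (* Otherwise [a], [b], [u], [v] would be a path whose end [v] can only go to [a] or [b]. *)
  have no_back u v : u \in S -> v \in S -> v != u -> v != a -> u != a ->
      e b u -> e u v -> e v f -> False.
    move=> uS vS vu va ua ebu euv evf.
    have := path4_end aS bS uS vS eab ebu euv va fS evf.
    by case=> fE; [rewrite fE eqxx in fa | rewrite fE oriented_irr in efb].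
  have Nw : N w :&: S = [set f].
    apply: loneI => // u uS ewu.
    have [uc|//] := path4_end cS fS bS wS ecf efb ebw wc uS ewu.
    rewrite uc in ewu; rewrite eq_sym in wc; rewrite eq_sym in ac.
    by case: (no_back w c wS cS wc ac wa ebw ewu ecf).
  have Nc : N c :&: S = [set f].
    have [_ ewf _ _ _] := trap_lone tS wS Nw.
    apply: loneI => // u uS ecu.
    have cw : c != w by rewrite eq_sym.
    have [uw|//] := path4_end wS fS bS cS ewf efb ebc cw uS ecu.
    rewrite uw in ecu; rewrite eq_sym in ac.
    by case: (no_back c w cS wS wc wa ac ebc ecu ewf).
  apply: (no_lone_detour at5 tS cS Nc bS efb wS ebw wc Nw (t := f)).
    exact: setU11.
  by exists b.
have Nb : N b :&: S = [set c].
  apply: loneI => // w wS ebw; apply/eqP/negPn/negP => wc.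
  by case/negP: only_c; apply/existsP; exists w; rewrite wS ebw.
have [/existsP[w /and3P[wS ecw wf]]|only_f] :=
    boolP [exists w, [&& w \in S, e c w & w != f]].
  have Nw : N w :&: S = [set b].
    apply: loneI => // u uS ewu.
    have [uf|//] := path4_end fS bS cS wS efb ebc ecw wf uS ewu.
    by case: (no_cycle4 fS bS cS wS efb ebc ecw); rewrite -uf.
  apply: (no_lone_detour at5 tS fS Nf cS ebc wS ecw wf Nw (t := b)).
    exact: setU11.
  by exists c.
have Nc : N c :&: S = [set f].
  apply: loneI => // w wS ecw; apply/eqP/negPn/negP => wf.
  by case/negP: only_f; apply/existsP; exists w; rewrite wS ecw.
(* Only the triangle [b], [c], [f] of lone vertices remains. *)
exact: (no_lone_chain at5 _ tS bS Nb Nc Nf).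
Qed.

End Paths5.

Lemma not_anti_transitive k : 0 < k <= 5 -> (exists x, #|N x| = d) ->
  anti_transitive e k -> False.
Proof.
move=> k5 [x dx] atk; have [S sS ltS] := e_deficient x.
have tS := deficient_trap dx sS ltS.
(* Such a path, preceded by [x], has length [k], and [x] dominates its last vertex. *)
have no_pathk s : size s = k -> {subset s <= S} -> uniq s -> ~~ sorted e s.
  move=> sk sub us; apply/negP => ps.
  have ex y : y \in s -> e x y.
    by move=> ys; have := subsetP sS y (sub y ys); rewrite inE.
  case: s => [|y s] in sk sub us ps ex; first by rewrite -sk in k5.
  have us' : uniq (x :: y :: s).
    by rewrite cons_uniq us andbT; apply/negP => /ex; rewrite oriented_irr.
  have pxs : path e x (y :: s) by rewrite /= ex ?mem_head.
  by have := anti_transitive_path atk sk pxs us'; rewrite (ex _ (mem_last y s)).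
have [k3|k_gt3] := leqP k 3.
  have /andP[/set0Pn[a aS] _] := tS.
  have [b bS eab] := trap_next tS aS; have [c cS ebc] := trap_next tS bS.
  have ac : a != c by apply: contraTneq ebc => <-; rewrite oriented_asym.
  have sz : size (take k [:: a; b; c]) = k by rewrite size_takel.
  have sub : {subset take k [:: a; b; c] <= S}.
    by move=> z /mem_take; rewrite !inE => /or3P[]/eqP->.
  have := no_pathk _ sz sub; rewrite take_sorted /= ?eab ?ebc //.
  by rewrite take_uniq /= ?inE ?negb_or ?ac ?oriented_neq // => /(_ isT).
have k45 : 3 < k <= 5 by rewrite k_gt3; case/andP: k5.
apply: (trap_path4 atk k45 tS) => a b c f aS bS cS fS eab ebc ecf fa.
have [k4|k5'] : k = 4 \/ k = 5 by move: k45; clear; lia.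
  have ac : a != c by apply: contraTneq ebc => <-; rewrite oriented_asym.
  have bf : b != f by apply: contraTneq ecf => <-; rewrite oriented_asym.
  have := no_pathk [:: a; b; c; f] (esym k4).
  have sub : {subset [:: a; b; c; f] <= S}.
    by move=> z; rewrite !inE => /or4P[]/eqP->.
  rewrite /= eab ebc ecf => /(_ sub) no_path; apply: notF; apply: no_path.
  rewrite !inE !negb_or ac bf; move/eqP: fa; rewrite eq_sym => ->.
  by rewrite !oriented_neq.
rewrite k5' in atk no_pathk.
exact: (no_path4 atk tS no_pathk aS bS cS fS eab ebc ecf fa).
Qed.

End Counterexample.

End OutSets.

Theorem theorem1p5 (T : finType) (e : rel T)
  (hT : 0 < #|T|)
  (he : oriented_graph e)
  (hD : min_out_degree e <= 5 \/ at_index e <= 5) :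
  exists x : T, strong_seymour_vertex e x.
Proof.
have [x0 _] := card_gt0P hT.
have [/existsP[x /forallP hall]|/existsPn no_hall] :=
    boolP [exists x, [forall S : {set T}, (S \subset out_nbrs e x) ==>
      (#|S| <= #|out_set e S :\: out_nbrs e x|)]].
  exists x; apply: strong_seymour_hall => // S sS.
  by have /implyP := hall S; apply.
exfalso.
have deficient x : exists2 S : {set T}, S \subset out_nbrs e x &
    #|out_set e S :\: out_nbrs e x| < #|S|.
  have := no_hall x; rewrite negb_forall => /existsP[S].
  by rewrite negb_imply -ltnNge => /andP[sS ltS]; exists S.
case: (@arg_minnP T x0 xpredT (out_degree e) isT) => x _ x_min.
have {}x_min y : #|out_nbrs e x| <= #|out_nbrs e y| by apply: x_min.
case: hD => [le_min|].
  have := min_out_degree_gt5 he x_min deficient (erefl #|out_nbrs e x|).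
  rewrite ltnNge => /negP; apply; apply: leq_trans le_min.
  (* The default [#|T|] of the minimum is also at least the out-degree of [x]. *)
  rewrite /min_out_degree; elim/big_ind: _ => [|m n lem len|y _].
  - exact: max_card.
  - by rewrite leq_min lem.
  - exact: x_min.
rewrite /at_index; case: ex_minnP => k /andP[k_gt0 atk] _ k_le5.
apply: (not_anti_transitive he x_min deficient _ _ atk); last by exists x.
by rewrite k_gt0.
Qed.
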